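(* Let $d\ge1$ and $1<p<+\infty$. Let $F:\mathbb{R}^d\to\mathbb{R}^d$, $F=F(x)$, be a Lipschitz vector field. There exists a time $\tau>0$, depending only on $\|\nabla_x F\|_{L^\infty}$ (the dimension $d$ being fixed), such that for every $f^0\in L^p(\mathbb{R}^d_x\times\mathbb{R}^d_v)$, if $f$ is the solution to the transport equation $$\partial_t f+v\cdot\nabla_x f+F\cdot\nabla_v f=0,\qquad f(0,\cdot,\cdot)=f^0,$$ then for all $t$ with $0<|t|\le\tau$, $$\|f(t)\|_{L^\infty_x(L^1_v)}\le\frac{2}{|t|^d}\,\|f^0\|_{L^1_x(L^\infty_v)}.$$
   Context: The norms are $\|h\|_{L^\infty_x(L^1_v)}=\operatorname{ess\,sup}_{x}\int|h(x,v)|\,dv$ and $\|h\|_{L^1_x(L^\infty_v)}=\int\operatorname{ess\,sup}_v|h(x,v)|\,dx$ (possibly $+\infty$). The solution of the transport equation is the unique distributional solution, given by $f(t,x,v)=f^0(X(-t;x,v),V(-t;x,v))$, where $t\mapsto(X(t;x_0,v_0),V(t;x_0,v_0))$ solves $X'=V$, $V'=F(X)$, with $(X,V)(0;x_0,v_0)=(x_0,v_0)$. *)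

(* Defs.v *)
From HB Require Import structures.
From mathcomp Require Import all_boot all_order all_algebra.
From mathcomp Require Import all_classical all_reals all_analysis.
From mathcomp Require Import ess_sup_inf.

Set Implicit Arguments.
Unset Strict Implicit.
Unset Printing Implicit Defensive.

Import Order.TTheory GRing.Theory Num.Theory.
Import numFieldNormedType.Exports.

Local Open Scope classical_set_scope.
Local Open Scope ring_scope.

Definition rV_display : measure_display.
Proof. exact: default_measure_display. Qed.

Section rV_measurable.
Context {R : realType} (n : nat).

Definition rV_coor (i : 'I_n) (x : 'rV[R]_n) : measurableTypeR R := x ord0 i.

Let rV_set0 : g_sigma_preimage rV_coor set0.
Proof. exact: sigma_algebra0. Qed.

Let rV_setC A : g_sigma_preimage rV_coor A -> g_sigma_preimage rV_coor (~` A).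
Proof. exact: sigma_algebraC. Qed.

Let rV_bigcup (F : _^nat) : (forall i, g_sigma_preimage rV_coor (F i)) ->
  g_sigma_preimage rV_coor (\bigcup_i (F i)).
Proof. exact: sigma_algebra_bigcup. Qed.

HB.instance Definition _ := @isMeasurable.Build rV_display
  'rV[R]_n (g_sigma_preimage rV_coor) rV_set0 rV_setC rV_bigcup.

Lemma measurable_rV_coor (i : 'I_n) : measurable_fun [set: 'rV[R]_n] (rV_coor i).
Proof.
move=> _ Y mY; rewrite setTI; apply: sub_sigma_algebra => /=.
rewrite -bigcup_seq/=; exists i => /=; first by rewrite mem_index_enum.
by exists Y => //; rewrite setTI.
Qed.

Lemma measurable_fun_rVP d (T : measurableType d) (f : T -> 'rV[R]_n) :
  measurable_fun [set: T] f <->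
  forall i, measurable_fun [set: T] (rV_coor i \o f).
Proof.
apply: (@iff_trans _ (g_sigma_preimage (fun i => rV_coor i \o f)
    `<=` measurable)).
  rewrite g_sigma_preimage_comp; split=> [mf A [/= C preC <-]|prefS].
    exact: mf.
  by move=> _ A mA; apply: prefS; exists A.
split=> [rVfS i _ A mA|mf].
  apply: rVfS; apply: sub_sigma_algebra; rewrite -bigcup_seq.
  by exists i; [rewrite /= mem_index_enum|exists A].
apply: smallest_sub; first exact: sigma_algebra_measurable.
rewrite -bigcup_seq; apply: bigcup_sub => i _ _ [B mB <-]; exact: mf.
Qed.

End rV_measurable.

Section cons_rV.
Context {R : realType} (n : nat).

Definition cons_rV (z : measurableTypeR R * 'rV[R]_n) : 'rV[R]_n.+1 :=
  row_mx (z.1)%:M z.2.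

Lemma cons_rV0 z : cons_rV z ord0 ord0 = z.1.
Proof.
have -> : ord0 = lshift n (ord0 : 'I_1) :> 'I_(1 + n) by exact: val_inj.
by rewrite /cons_rV (row_mxEl (z.1)%:M) mxE.
Qed.

Lemma cons_rVS z (i : 'I_n) : cons_rV z ord0 (lift ord0 i) = z.2 ord0 i.
Proof.
have -> : lift ord0 i = rshift 1 i :> 'I_(1 + n) by exact: val_inj.
by rewrite /cons_rV (row_mxEr (z.1)%:M).
Qed.

Lemma cons_rV_surj (x : 'rV[R]_n.+1) :
  x = cons_rV (x ord0 ord0, \row_j x ord0 (lift ord0 j)).
Proof.
apply/rowP => i; case: (unliftP ord0 i) => [j|] ->.
  by rewrite cons_rVS mxE.
by rewrite cons_rV0.
Qed.

Lemma measurable_cons_rV :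
  measurable_fun [set: measurableTypeR R * 'rV[R]_n] cons_rV.
Proof.
apply/measurable_fun_rVP => i; case: (unliftP ord0 i) => [j|] ->.
  rewrite (_ : _ \o _ = rV_coor j \o snd); last first.
    by apply/funext => z; exact: cons_rVS.
  exact: measurableT_comp (measurable_rV_coor j) measurable_snd.
rewrite (_ : _ \o _ = fst); first exact: measurable_fst.
by apply/funext => z; exact: cons_rV0.
Qed.

Variable mu : {sigma_finite_measure set 'rV[R]_n -> \bar R}.

Definition leb_cons : set 'rV[R]_n.+1 -> \bar R :=
  pushforward (lebesgue_measure \x mu)%E cons_rV.

Let leb_cons0 : leb_cons set0 = 0%E.
Proof. by rewrite /leb_cons /pushforward preimage_set0 measure0. Qed.

Let leb_cons_ge0 A : (0 <= leb_cons A)%E.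
Proof. by rewrite /leb_cons /pushforward; exact: measure_ge0. Qed.

Let leb_cons_sigma_additive : semi_sigma_additive leb_cons.
Proof.
move=> F mF tF mUF; rewrite /leb_cons /pushforward preimage_bigcup.
apply: measure_semi_sigma_additive.
- by move=> k; rewrite -[X in measurable X]setTI; exact: measurable_cons_rV.
- apply/trivIsetP => /= i j _ _ ij; rewrite -preimage_setI.
  by move/trivIsetP : tF => /(_ _ _ _ _ ij) ->//; rewrite preimage_set0.
- by rewrite -preimage_bigcup -[X in measurable X]setTI;
    exact: measurable_cons_rV.
Qed.

HB.instance Definition _ := isMeasure.Build _ _ _ leb_cons
  leb_cons0 leb_cons_ge0 leb_cons_sigma_additive.

Let uncons_rV (x : 'rV[R]_n.+1) : measurableTypeR R * 'rV[R]_n :=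
  (x ord0 ord0, \row_j x ord0 (lift ord0 j)).

Let cons_rVK : cancel cons_rV uncons_rV.
Proof.
move=> [a v]; rewrite /uncons_rV cons_rV0; congr pair.
by apply/rowP => j; rewrite mxE cons_rVS.
Qed.

Let measurable_uncons_rV : measurable_fun [set: 'rV[R]_n.+1] uncons_rV.
Proof.
apply/measurable_fun_pair; first exact: (measurable_rV_coor ord0).
apply/measurable_fun_rVP => j.
rewrite (_ : _ \o _ = rV_coor (lift ord0 j)).
  exact: measurable_rV_coor.
by apply/funext => x; rewrite /rV_coor /= mxE.
Qed.

Let leb_cons_sigma_finite : sigma_finite setT leb_cons.
Proof.
have /sigma_finiteP[F [TF ndF Foo]] :=
  sigma_finiteT (@lebesgue_measure R).
have /sigma_finiteP[G [TG ndG Goo]] := sigma_finiteT mu.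
exists (fun k => uncons_rV @^-1` (F k `*` G k)).
  rewrite -preimage_bigcup (_ : \bigcup_k _ = setT) ?preimage_setT//.
  rewrite -subTset => -[x y] _.
  have [i _ Fix] : (\bigcup_k F k) x by rewrite -TF.
  have [j _ Gjy] : (\bigcup_k G k) y by rewrite -TG.
  exists (maxn i j) => //; split.
    by move: x Fix; exact/subsetPset/ndF/leq_maxl.
  by move: y Gjy; exact/subsetPset/ndG/leq_maxr.
move=> k; have [mF Fk] := Foo k; have [mG Gk] := Goo k; split.
  rewrite -[X in measurable X]setTI; apply: measurable_uncons_rV => //.
  exact: measurableX.
rewrite /leb_cons /pushforward -comp_preimage.
rewrite (_ : uncons_rV \o cons_rV = id); last by apply/funext => z /=.
by rewrite preimage_id product_measure1E// lte_mul_pinfty// ge0_fin_numE.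
Qed.

HB.instance Definition _ := Measure_isSigmaFinite.Build _ _ _ leb_cons
  leb_cons_sigma_finite.

End cons_rV.

(* Lebesgue measure on R^n, on the Borel sigma-algebra: the n-fold product of
   the Lebesgue measure on R (a unit point mass for n = 0). *)
Fixpoint leb {R : realType} (n : nat) :
    {sigma_finite_measure set 'rV[R]_n -> \bar R} :=
  if n is m.+1 then leb_cons (leb m) else \d_(0 : 'rV[R]_0).

Lemma leb_box {R : realType} (n : nat) (a b : 'rV[R]_n) :
  (forall i, a ord0 i <= b ord0 i) ->
  leb n [set x | forall i, x ord0 i \in `[a ord0 i, b ord0 i]] =
  (\prod_(i < n) (b ord0 i - a ord0 i))%:E.
Proof.
elim: n a b => [|n IH] a b ab.
  rewrite big_ord0 /= diracE mem_set//= => i; by case: i.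
rewrite big_ord_recl /= /leb_cons /pushforward.
pose a' := \row_j a ord0 (lift ord0 j); pose b' := \row_j b ord0 (lift ord0 j).
set B := [set x : 'rV[R]_n |
  forall i, x ord0 i \in `[a' ord0 i, b' ord0 i]].
have mB : measurable B.
  rewrite (_ : B = \bigcap_(i in [set: 'I_n])
     (rV_coor i @^-1` `[a' ord0 i, b' ord0 i])).
    apply: fin_bigcap_measurable => // i _; rewrite -[X in measurable X]setTI.
    by apply: measurable_rV_coor => //; exact: measurable_itv.
  by apply/seteqP; split=> x /= Bx i; [move=> _|]; exact: Bx.
rewrite (_ : _ @^-1` _ = `[a ord0 ord0, b ord0 ord0]%classic `*` B); last first.
  apply/seteqP; split => [z /= Bz|z /= [z1 Bz] i].
    split; first by have := Bz ord0; rewrite cons_rV0.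
    by move=> i; have := Bz (lift ord0 i); rewrite cons_rVS !mxE.
  case: (unliftP ord0 i) => [j|] ->; last by rewrite cons_rV0.
  by have := Bz j; rewrite cons_rVS !mxE.
have mI : measurable
    (`[a ord0 ord0, b ord0 ord0]%classic : set (measurableTypeR R)).
  exact: measurable_itv.
rewrite (product_measure1E _ _ mI mB).
have lebI : lebesgue_measure (`[a ord0 ord0, b ord0 ord0]%classic) =
    (b ord0 ord0 - a ord0 ord0)%:E.
  rewrite lebesgue_measure_itv/= lte_fin -EFinB.
  case: ltP => // ba; have -> : b ord0 ord0 = a ord0 ord0.
    by apply/eqP; rewrite eq_le ba ab.
  by rewrite subrr.
rewrite EFinM; apply: congr2; first exact: lebI.
rewrite IH; first by congr EFin; apply: eq_bigr => i _; rewrite !mxE.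
by move=> i; rewrite !mxE.
Qed.

Section transport.
Context {R : realType} (d : nat).
Local Notation E := 'rV[R]_d.
Implicit Types (F : E -> E) (h : E * E -> R).

Definition leb2 : {measure set (E * E) -> \bar R} := (leb d \x leb d)%E.

(* Off the points of differentiability, a Lebesgue null set when [F] is
   Lipschitz (Rademacher), the derivative norm is set to +oo. The matrix norm
   is the library's, the largest absolute value of an entry. *)
Definition grad_norm F (x : E) : \bar R :=
  if `[< differentiable F x >] then `|'J F x|%:E else +oo%E.

Definition grad_Linfty F : \bar R := ess_sup (leb d) (grad_norm F).

Definition is_flow F (X V : R -> E * E -> E) : Prop :=
  forall z, [/\ X 0 z = z.1, V 0 z = z.2 &
    forall t : R, is_derive t (1 : R) (X ^~ z) (V t z) /\
                  is_derive t (1 : R) (V ^~ z) (F (X t z))].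

(* [f t] is a representative of the class f(t), so the formula along the
   characteristics is only required almost everywhere in (x, v). *)
Definition transport_solution F (f0 : E * E -> R) (f : R -> E * E -> R) : Prop :=
  exists X V, is_flow F X V /\
    forall t, measurable_fun setT (f t) /\
      {ae leb2, forall z, f t z = f0 (X (- t) z, V (- t) z)}.

Definition norm_Linfty_L1 h : \bar R :=
  ess_sup (leb d) (fun x => \int[leb d]_v `|h (x, v)|%:E)%E.

Definition norm_L1_Linfty h : \bar R :=
  (\int[leb d]_x ess_sup (leb d) (fun v => `|h (x, v)|%:E))%E.

End transport.

(* Main.v *)
Require Import Defs.
From mathcomp Require Import all_boot all_order all_algebra.
From mathcomp Require Import all_classical all_reals all_analysis.
From mathcomp Require Import measurable_realfun ess_sup_inf ring lra.

Set Implicit Arguments.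
Unset Strict Implicit.
Unset Printing Implicit Defensive.

Import Order.TTheory GRing.Theory Num.Theory.
Import numFieldNormedType.Exports.
Local Open Scope classical_set_scope.
Local Open Scope ring_scope.

(** The field is only known through the essential supremum of its Jacobian,
    but that is enough to make it Lipschitz with a constant [K] depending on
    [M] and [d] alone.  Over a time [T] with [(1 + K) T] small, the flow then
    stays close to free transport: two characteristics issued from the same
    position [x] with velocities [v] and [w] are, at time [t], at distance at
    least [|t| (1 - 2 K T) |v - w|] from each other ([flow_dispersion]).

    The map [v |-> X(-t; x, v)] is thus expansive.  Because the norm is the sup
    norm, its balls are cubes, so that the preimage of a cube of side [s] under
    a map that expands distances by a factor [1 / L] lies in a cube of side
    [L s].  Comparing two measures on dyadic cubes is enough to compare them on
    Borel sets, hence such a preimage map multiplies Lebesgue measure by at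
    most [L ^ d] ([expansive_preimage]).  This takes the place of a change of
    variables, and the constant is sharp enough:
    [L ^ d = |t| ^ - d (1 - 2 K T) ^ - d], where the last factor is at most 2
    by the inequality of Bernoulli.

    Given this, bound [|f0(y, w)|] by [g(y)], its essential supremum in [w].
    For almost every [x], [|f(t, x, v)| <= g(X(-t; x, v))] for almost every
    [v], and integrating in [v] costs the factor above
    ([transport_Linfty_L1_le]).  The exceptional points form a null set
    because the flow on phase space is expansive too, so that
    [expansive_preimage] shows preimages of null sets to be null.

    The Lipschitz bound ([grad_Linfty_lipschitz]) is obtained on lines: by
    translation invariance, almost every line in a given direction meets the
    exceptional set of [F] in a null set, and a Lipschitz function of one
    variable whose derivative is almost everywhere at most [m] grows by at most
    [m] on the unit interval ([lipschitz_ae_derive_le]). *)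

(** * Measures on a refining sequence of countable partitions *)

Definition grid_sets {T : Type} (q : nat -> T -> nat) : set (set T) :=
  [set A | exists n S, A = q n @^-1` S].

Section grid_sets.
Context {T : Type} (q : nat -> T -> nat).
Hypothesis q_refine : forall n x y, q n.+1 x = q n.+1 y -> q n x = q n y.

Lemma grid_refine n m x y : (n <= m)%N -> q m x = q m y -> q n x = q n y.
Proof.
elim: m => [|m IH]; first by rewrite leqn0 => /eqP ->.
by rewrite leq_eqVlt => /predU1P[->//|nm] /q_refine; exact: IH.
Qed.

Lemma grid_lift n m S : (n <= m)%N -> exists S', q n @^-1` S = q m @^-1` S'.
Proof.
move=> nm; exists (q m @` (q n @^-1` S)); apply/seteqP; split=> x /=.
  by move=> Sx; exists x.
by move=> [y Sy /(grid_refine nm)] <-.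
Qed.

(** Refinement makes the unions of cells of all levels an algebra: two of them
    can be written as unions of cells of the same, finer, level. *)
Lemma grid_common A B : grid_sets q A -> grid_sets q B ->
  exists n S S', A = q n @^-1` S /\ B = q n @^-1` S'.
Proof.
move=> [n [S ->]] [m [S' ->]].
have [U ->] := grid_lift S (leq_maxl n m).
by have [V ->] := grid_lift S' (leq_maxr n m); exists (maxn n m), U, V.
Qed.

Lemma grid_sets_setring : setring (grid_sets q).
Proof.
split; first by exists 0%N, set0; rewrite preimage_set0.
- by move=> A B /grid_common/[apply] -[n [S [S' [-> ->]]]]; exists n, (S `|` S').
- by move=> A B /grid_common/[apply] -[n [S [S' [-> ->]]]]; exists n, (S `\` S').
Qed.

(** Induction through monotone limits, starting from an algebra.  A pi-lambda
    argument would not do for an inequality between measures, which does not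
    pass to differences of sets. *)
Lemma grid_sets_ind (M : set (set T)) : monotone M -> grid_sets q `<=` M ->
  <<s grid_sets q >> `<=` M.
Proof.
move=> mM gM.
apply: subset_trans (monotone_setring_sub_g_sigma_ring mM grid_sets_setring gM).
have [sr0 srD srU] := smallest_sigma_ring (grid_sets q).
apply: smallest_sub; last exact: sub_g_sigma_ring.
split=> // A; apply: srD; apply: sub_g_sigma_ring.
by exists 0%N, setT; rewrite preimage_setT.
Qed.

End grid_sets.

Section grid_functions.
Context {disp : measure_display} {T : measurableType disp} {R : realType}.
Variable q : nat -> T -> nat.
Hypothesis q_cell : forall n k, measurable (q n @^-1` [set k]).

Lemma measurable_grid_set n S : measurable (q n @^-1` S).
Proof.
rewrite (_ : _ @^-1` _ = \bigcup_(k in S) q n @^-1` [set k]).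
  by apply: bigcup_measurable => k _; exact: q_cell.
by apply/seteqP; split=> [x Sx|x [k Sk /= ->//]]; exists (q n x).
Qed.

(** Such a function is the pointwise limit of functions constant on the cells
    of level [n], and those are measurable because there are countably many
    cells.  For dyadic cubes this covers Lipschitz functions; applied to the
    sigma-algebra generated by the grid itself, it shows that the grid
    generates the Borel sets. *)
Lemma measurable_fun_grid (K : R) (f : T -> R) :
  (forall n x y, q n x = q n y -> `|f x - f y| <= K / 2 ^+ n) ->
  measurable_fun setT f.
Proof.
move=> fK.
pose g n k := if pselect (exists x, q n x = k) is left e
              then f (projT1 (cid e)) else 0.
apply: (@measurable_realfun.measurable_fun_cvg _ _ _ _ (fun n => g n \o q n)).
  move=> n _ Y mY; rewrite setTI comp_preimage; exact: measurable_grid_set.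
move=> x _; apply/cvgrPdist_le => e e0.
have gx n : `|f x - g n (q n x)| <= `|K| / 2 ^+ n.
  rewrite /g; case: pselect => [ex|[]]; last by exists x.
  case: cid => /= y /esym/fK /le_trans -> //.
  by rewrite ler_wpM2r// ?invr_ge0 ?exprn_ge0// ler_norm.
have : `|K| / 2 ^+ n @[n --> \oo] --> 0.
  rewrite -[X in _ --> X](mulr0 `|K|); apply: cvgM; first exact: cvg_cst.
  under eq_fun do rewrite -exprVn.
  by apply: cvg_expr; rewrite ger0_norm; lra.
move/cvgrPdist_le => /(_ _ e0); apply: filterS => n /=.
by rewrite sub0r normrN ger0_norm ?mulr_ge0 ?invr_ge0 ?exprn_ge0//; apply: le_trans.
Qed.

End grid_functions.

Section grid_measures.
Context {disp : measure_display} {T : measurableType disp} {R : realType}.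
Variable q : nat -> T -> nat.
Hypothesis q_refine : forall n x y, q n.+1 x = q n.+1 y -> q n x = q n y.
Hypothesis q_cell : forall n k, measurable (q n @^-1` [set k]).
Hypothesis q_gen : measurable `<=` <<s grid_sets q >>.

Lemma measure_grid_sum (mu : {measure set T -> \bar R}) n A : measurable A ->
  (mu A = \sum_(0 <= k <oo) mu (A `&` q n @^-1` [set k]))%E.
Proof.
move=> mA; rewrite -measure_semi_bigcup.
- congr (mu _); apply/seteqP; split=> [x Ax|x [k _ []]//].
  by exists (q n x).
- by move=> k; apply: measurableI => //; exact: q_cell.
- exact/trivIset_setIl/trivIset_preimage1.
- by apply: bigcup_measurable => k _; apply: measurableI => //; exact: q_cell.
Qed.

(** Inside a cell of level 0 the measures are finite, so the inequality is
    preserved by increasing and by decreasing limits. *)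
Lemma le_measure_grid (mu nu : {measure set T -> \bar R}) :
  (forall k, nu (q 0%N @^-1` [set k]) < +oo)%E ->
  (forall n k, mu (q n @^-1` [set k]) <= nu (q n @^-1` [set k]))%E ->
  forall A, measurable A -> (mu A <= nu A)%E.
Proof.
move=> nu_fin mu_nu.
have grid_le A : grid_sets q A -> (mu A <= nu A)%E.
  move=> [n [S ->]].
  rewrite (measure_grid_sum mu n) ?(measure_grid_sum nu n);
    do ?exact: measurable_grid_set.
  apply: lee_nneseries => [//|k _].
  rewrite -preimage_setI; have [Sk|Sk] := pselect (S k).
    by rewrite setIC setIidl// => _ ->.
  rewrite (_ : S `&` _ = set0) ?preimage_set0 ?measure0//.
  by apply/seteqP; split=> // j [Sj /= jk]; rewrite jk in Sj.
have cell_le k A : measurable A ->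
    (mu (A `&` q 0%N @^-1` [set k]) <= nu (A `&` q 0%N @^-1` [set k]))%E.
  set C := q 0%N @^-1` [set k].
  have mC : measurable C by exact: q_cell.
  move=> /q_gen.
  suff : <<s grid_sets q >> `<=`
      [set B | measurable B /\ (mu (B `&` C) <= nu (B `&` C))%E].
    by move=> /[apply] -[].
  apply: grid_sets_ind => //; last first.
    move=> B gB; split.
      by have [n [S ->]] := gB; exact: measurable_grid_set.
    apply: grid_le; have gC : grid_sets q C by exists 0%N, [set k].
    have [n [S [S' [-> ->]]]] := grid_common q_refine gB gC.
    by exists n, (S `&` S').
  split=> F Fmono FM.
    have mF i : measurable (F i) by have [] := FM i.
    split; first exact: bigcup_measurable.
    rewrite setI_bigcupl.
    have mFC i : measurable (F i `&` C) by exact: measurableI.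
    have ndFC : {homo (fun i => F i `&` C) : n m / (n <= m)%N >-> (n <= m)%O}.
      by move=> n m nm; apply/subsetPset; apply: setSI; exact/subsetPset/Fmono.
    have mU := bigcup_measurable (P := setT) (fun k _ => mFC k).
    apply: (lee_cvg_to (nondecreasing_cvg_mu (mu := mu) mFC mU ndFC)
                       (nondecreasing_cvg_mu (mu := nu) mFC mU ndFC)).
    apply: nearW => n /=.
    by have [] := FM n.
  have mF i : measurable (F i) by have [] := FM i.
  split; first exact: bigcap_measurable.
  rewrite -bigcapIl//.
  have mFC i : measurable (F i `&` C) by exact: measurableI.
  have ndFC : {homo (fun i => F i `&` C) : n m / (n <= m)%N >-> (m <= n)%O}.
    by move=> n m nm; apply/subsetPset; apply: setSI; exact/subsetPset/Fmono.
  have mU := bigcap_measurable (P := setT) (ex_intro _ 0%N I) (fun k _ => mFC k).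
  have fin0 (lam : {measure set T -> \bar R}) : (lam C < +oo -> lam (F 0%N `&` C) < +oo)%E.
    by apply: le_lt_trans; apply: le_measure; rewrite ?inE//; exact: subIsetr.
  have muC : (mu C < +oo)%E by apply: le_lt_trans (mu_nu 0%N k) (nu_fin k).
  apply: (lee_cvg_to
    (nonincreasing_cvg_mu (mu := mu) (fin0 _ muC) mFC mU ndFC)
    (nonincreasing_cvg_mu (mu := nu) (fin0 _ (nu_fin k)) mFC mU ndFC)).
  apply: nearW => n /=.
  by have [] := FM n.
move=> A mA; rewrite (measure_grid_sum mu 0) ?(measure_grid_sum nu 0)//.
by apply: lee_nneseries => [//|k _]; exact: cell_le.
Qed.

End grid_measures.

(** * Expansive maps on spaces with a cubical grid *)

(** The cells of level [n] are cubes of side [2 ^ - n] in dimension [D], and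
    [dist] plays the part of the sup distance: [mg_cover] says that its balls
    are cubes, so that a set of diameter [delta] has mass at most
    [delta ^ D], without the constant that another norm would bring. *)
Record metric_grid {disp} {T : measurableType disp} {R : realType}
    (q : nat -> T -> nat) (dist : T -> T -> R) (D : nat)
    (nu : set T -> \bar R) : Prop := MetricGrid {
  mg_refine : forall n x y, q n.+1 x = q n.+1 y -> q n x = q n y ;
  mg_cell : forall n k, measurable (q n @^-1` [set k]) ;
  mg_gen : measurable `<=` <<s grid_sets q >> ;
  mg_near : forall n x y, q n x = q n y -> dist x y <= (2 ^+ n)^-1 ;
  mg_mass : forall n x, nu (q n @^-1` [set q n x]) = ((2 ^+ n)^-1 ^+ D)%:E ;
  mg_cover : forall (S : set T) (delta : R), 0 <= delta ->
    (forall x y, S x -> S y -> dist x y <= delta) ->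
    exists2 B, measurable B /\ S `<=` B & (nu B <= (delta ^+ D)%:E)%E }.

(** The preimage of a cell of side [2 ^ - n] has diameter at most
    [L 2 ^ - n], hence mass at most [L ^ D] times that of the cell; cells
    suffice by [le_measure_grid]. *)
Lemma expansive_preimage disp (T : measurableType disp) (R : realType)
    (q : nat -> T -> nat) dist D (nu : {measure set T -> \bar R}) (L : R) (G : T -> T) :
  metric_grid q dist D nu ->
  measurable_fun setT G -> 0 <= L ->
  (forall x y, dist x y <= L * dist (G x) (G y)) ->
  forall A, measurable A -> (nu (G @^-1` A) <= (L ^+ D)%:E * nu A)%E.
Proof.
case=> refine cell gen near mass cover mG L0 GL.
have cellT n k : q n @^-1` [set k] = set0 \/ exists x, k = q n x.
  have [[x xk]|nx] := pselect (exists x, q n x = k); first by right; exists x.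
  by left; apply/seteqP; split=> // x /= xk; case: nx; exists x.
pose mu : {measure set T -> \bar R} :=
  measure_function_pushforward__canonical__measure_function_Measure nu mG.
pose c : {nonneg R} := NngNum (exprn_ge0 D L0).
pose lam : {measure set T -> \bar R} := mscale c nu.
have lamE A : (lam A = (L ^+ D)%:E * nu A)%E by [].
apply: (le_measure_grid (mu := mu) (nu := lam) refine cell gen).
  move=> k; have [->|[x ->]] := cellT 0%N k; first by rewrite measure0.
  by rewrite lamE mass -EFinM ltry.
move=> n k; have [->|[x ->]] := cellT n k; first by rewrite !measure0.
have delta0 : 0 <= L * (2 ^+ n)^-1 by rewrite mulr_ge0// invr_ge0 exprn_ge0.
have [y z|B [mB SB] nuB] := cover (G @^-1` (q n @^-1` [set q n x])) _ delta0.
  move=> /= yx zx; apply: le_trans (GL _ _) _; rewrite ler_wpM2l//.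
  by apply: near; rewrite yx zx.
rewrite lamE mass -EFinM -exprMn; apply: le_trans nuB.
apply: (@le_measure _ _ _ nu); rewrite ?inE//.
by rewrite -[X in measurable X]setTI; apply: (mG) => //; exact: cell.
Qed.

Lemma preimage_generated T T' (f : T -> T') (G : set (set T')) (H : set (set T)) :
  (forall A, G A -> <<s H >> (f @^-1` A)) ->
  forall A, <<s G >> A -> <<s H >> (f @^-1` A).
Proof.
move=> GH; suff : <<s G >> `<=` [set A | <<s H >> (f @^-1` A)] by [].
apply: smallest_sub => //; split=> [|B sB|F sF] /=.
- by rewrite preimage_set0; exact: sigma_algebra0.
- by rewrite setTD preimage_setC -setTD; exact: sigma_algebraCD.
- by rewrite preimage_bigcup; exact: sigma_algebra_bigcup.
Qed.

Section product_grid.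
Context {d1 d2 : measure_display} {T1 : measurableType d1} {T2 : measurableType d2}.
Context {R : realType} (q1 : nat -> T1 -> nat) (q2 : nat -> T2 -> nat).

Definition pair_grid n (z : T1 * T2) : nat := pickle (q1 n z.1, q2 n z.2).

Lemma pair_gridP n z w :
  pair_grid n z = pair_grid n w <-> q1 n z.1 = q1 n w.1 /\ q2 n z.2 = q2 n w.2.
Proof.
by split=> [/(pcan_inj pickleK)[-> ->]//|[e1 e2]]; rewrite /pair_grid e1 e2.
Qed.

Lemma pair_grid_cell n z : pair_grid n @^-1` [set pair_grid n z] =
  q1 n @^-1` [set q1 n z.1] `*` q2 n @^-1` [set q2 n z.2].
Proof. by apply/seteqP; split=> w /= /pair_gridP. Qed.

Variables (dist1 : T1 -> T1 -> R) (dist2 : T2 -> T2 -> R) (D1 D2 : nat).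
Variables (nu1 : {measure set T1 -> \bar R}) (nu2 : {sigma_finite_measure set T2 -> \bar R}).
Hypotheses (grid1 : metric_grid q1 dist1 D1 nu1) (grid2 : metric_grid q2 dist2 D2 nu2).

(** Serves to give a grid to phase space: the distance is a maximum, so a cube
    of the product is a product of cubes. *)
Lemma metric_grid_pair : metric_grid pair_grid
  (fun z w => Num.max (dist1 z.1 w.1) (dist2 z.2 w.2)) (D1 + D2) (nu1 \x nu2)%E.
Proof.
case: grid1 grid2 => refine1 cell1 gen1 near1 mass1 cover1.
case=> refine2 cell2 gen2 near2 mass2 cover2.
have refine n x y : pair_grid n.+1 x = pair_grid n.+1 y ->
    pair_grid n x = pair_grid n y.
  by move=> /pair_gridP[? ?]; apply/pair_gridP; split; [exact: refine1|exact: refine2].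
split=> //.
- move=> n k; have [[z <-]|nz] := pselect (exists z, pair_grid n z = k).
    by rewrite pair_grid_cell; apply: measurableX; [exact: cell1|exact: cell2].
  rewrite (_ : _ @^-1` _ = set0)//.
  by apply/seteqP; split=> // z /= zk; case: nz; exists z.
- have sub1 A : measurable A -> <<s grid_sets pair_grid >> (fst @^-1` A).
    move=> /gen1; apply: preimage_generated => _ [n [S ->]].
    apply: sub_sigma_algebra; exists n, (pair_grid n @` (fst @^-1` (q1 n @^-1` S))).
    apply/seteqP; split=> z /=; first by exists z.
    by move=> [w Sw /pair_gridP[<- _]].
  have sub2 A : measurable A -> <<s grid_sets pair_grid >> (snd @^-1` A).
    move=> /gen2; apply: preimage_generated => _ [n [S ->]].
    apply: sub_sigma_algebra; exists n, (pair_grid n @` (snd @^-1` (q2 n @^-1` S))).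
    apply/seteqP; split=> z /=; first by exists z.
    by move=> [w Sw /pair_gridP[_ <-]].
  rewrite measurable_prod_measurableType.
  apply: smallest_sub; first exact: smallest_sigma_algebra.
  move=> _ [A mA [B mB <-]].
  rewrite (_ : A `*` B = fst @^-1` A `&` snd @^-1` B)//.
  apply: (@measurableI _ (g_sigma_algebraType (grid_sets pair_grid))).
    exact: sub1.
  exact: sub2.
- by move=> n z w /pair_gridP[z1 z2]; rewrite ge_max near1// near2.
- move=> n z; rewrite pair_grid_cell.
  rewrite [LHS](product_measure1E nu1 nu2 (cell1 _ _) (cell2 _ _)).
  by rewrite [X in (X * _)%E]mass1 [X in (_ * X)%E]mass2 -EFinM -exprD.
- move=> S delta delta0 Sd.
  have [x y [z Sz <-] [w Sw <-]|B1 [mB1 SB1] nuB1] := cover1 (fst @` S) _ delta0.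
    by have := Sd _ _ Sz Sw; rewrite ge_max => /andP[].
  have [x y [z Sz <-] [w Sw <-]|B2 [mB2 SB2] nuB2] := cover2 (snd @` S) _ delta0.
    by have := Sd _ _ Sz Sw; rewrite ge_max => /andP[].
  exists (B1 `*` B2).
    split; first exact: measurableX.
    by move=> z Sz; split; [apply: SB1|apply: SB2]; exists z.
  rewrite [leLHS](product_measure1E nu1 nu2 mB1 mB2) exprD EFinM.
  by apply: lee_pmul.
Qed.

End product_grid.

(** * The dyadic grid of Euclidean space *)

Section dyadic.
Context {R : realType} (d : nat).
Local Notation E := 'rV[R]_d.

Definition rect n (A : 'I_n -> set R) : set 'rV[R]_n :=
  [set x | forall i, A i (x ord0 i)].

Lemma measurable_rect n (A : 'I_n -> set R) :
  (forall i, measurable (A i)) -> measurable (rect A).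
Proof.
move=> mA; rewrite (_ : rect A = \bigcap_(i in [set: 'I_n]) (rV_coor i @^-1` A i)).
  apply: fin_bigcap_measurable => // i _; rewrite -[X in measurable X]setTI.
  by apply: measurable_rV_coor => //; exact: mA.
by apply/seteqP; split=> x /= Ax i; [move=> _|]; exact: Ax.
Qed.

Lemma leb_rect n (A : 'I_n -> set R) (m : 'I_n -> R) :
  (forall i, measurable (A i)) ->
  (forall i, lebesgue_measure (A i) = (m i)%:E) ->
  leb n (rect A) = (\prod_(i < n) m i)%:E.
Proof.
elim: n A m => [|n IH] A m mA Am.
  rewrite big_ord0 /= diracE mem_set//= => i; by case: i.
rewrite big_ord_recl /= /leb_cons /pushforward.
rewrite (_ : _ @^-1` _ = A ord0 `*` rect (fun i => A (lift ord0 i))); last first.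
  apply/seteqP; split => [z /= Bz|z /= [z1 Bz] i].
    split; first by have := Bz ord0; rewrite cons_rV0.
    by move=> i; have := Bz (lift ord0 i); rewrite cons_rVS.
  case: (unliftP ord0 i) => [j|] ->; last by rewrite cons_rV0.
  by have := Bz j; rewrite cons_rVS.
have mA0 : measurable (A ord0 : set (measurableTypeR R)) by exact: mA.
rewrite (product_measure1E _ _ mA0 (measurable_rect (fun i => mA (lift ord0 i)))).
by rewrite EFinM; apply: congr2; [exact: Am|exact: IH].
Qed.

Definition dyadic n (x : E) : nat :=
  pickle (\row_i Num.floor (2 ^+ n * x ord0 i) : 'rV[int]_d).

Lemma dyadicP n x y : dyadic n x = dyadic n y <->
  forall i, Num.floor (2 ^+ n * x ord0 i) = Num.floor (2 ^+ n * y ord0 i).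
Proof.
split=> [/(pcan_inj pickleK)/rowP xy i|xy]; first by have := xy i; rewrite !mxE.
by congr (pickle _); apply/rowP => i; rewrite !mxE.
Qed.

Lemma dyadic_refine n x y : dyadic n.+1 x = dyadic n.+1 y -> dyadic n x = dyadic n y.
Proof.
move=> /dyadicP xy; apply/dyadicP => i; move: (xy i).
suff half (u v : R) : Num.floor (2 * u) = Num.floor (2 * v) -> Num.floor u <= Num.floor v.
  rewrite !exprS -!mulrA => e.
  by apply/eqP; rewrite eq_le !half.
move=> e; rewrite floor_ge_int -(ler_pM2l (ltr0Sn _ 1)).
rewrite -[2 * (Num.floor u)%:~R](intrM _ 2) -floor_ge_int -e floor_ge_int intrM.
by rewrite ler_pM2l// ge_floor.
Qed.

Definition dyadic_side n (a : R) : set R :=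
  [set b | Num.floor (2 ^+ n * b) = Num.floor (2 ^+ n * a)].

Lemma dyadic_sideE n a : dyadic_side n a =
  `[(Num.floor (2 ^+ n * a))%:~R / 2 ^+ n,
    (Num.floor (2 ^+ n * a))%:~R / 2 ^+ n + (2 ^+ n)^-1[%classic.
Proof.
have n0 : 0 < 2 ^+ n :> R by rewrite exprn_gt0.
apply/seteqP; split=> b /=; rewrite in_itv/= -{3}(mul1r (2 ^+ n)^-1) -mulrDl.
  move=> <-; rewrite ler_pdivrMr// ltr_pdivlMr// (mulrC b) ge_floor/=.
  by rewrite -[1]/1%:~R -intrD floorD1_gt.
rewrite ler_pdivrMr// ltr_pdivlMr// (mulrC b) => /andP[b1 b2].
by apply: floor_def; rewrite b1 intrD.
Qed.

Lemma dyadic_cell n x :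
  dyadic n @^-1` [set dyadic n x] = rect (fun i => dyadic_side n (x ord0 i)).
Proof. by apply/seteqP; split=> y /dyadicP. Qed.

Lemma measurable_dyadic_side n a : measurable (dyadic_side n a).
Proof. by rewrite dyadic_sideE; exact: measurable_itv. Qed.

Lemma entry_le_norm m n (A : 'M[R]_(m, n)) i j : `|A i j| <= `|A|.
Proof.
rewrite [leRHS]/Num.norm/= mx_normrE.
exact: (le_bigmax_cond _ (fun ij : 'I_m * 'I_n => `|A ij.1 ij.2|) (j := (i, j))).
Qed.

Lemma norm_leP (x : E) (r : R) : 0 <= r ->
  (`|x| <= r) <-> forall i, `|x ord0 i| <= r.
Proof.
move=> r0; split=> [xr i|xr]; first exact: le_trans (entry_le_norm x ord0 i) xr.
rewrite [leLHS]/Num.norm/= mx_normrE; apply/bigmax_leP; split=> // -[i j] _ /=.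
by rewrite (ord1 i).
Qed.

Lemma dyadic_near n x y : dyadic n x = dyadic n y -> `|x - y| <= (2 ^+ n)^-1.
Proof.
move=> /dyadicP xy; apply/norm_leP => [|i]; first by rewrite invr_ge0 exprn_ge0.
have : dyadic_side n (x ord0 i) (y ord0 i) by rewrite /dyadic_side/= xy.
have : dyadic_side n (x ord0 i) (x ord0 i) by [].
rewrite dyadic_sideE /= !in_itv/= !mxE => /andP[x1 x2] /andP[y1 y2].
by rewrite ler_norml; apply/andP; split; lra.
Qed.

Lemma metric_grid_dyadic : metric_grid dyadic (fun x y => `|x - y|) d (@leb R d).
Proof.
have cell n k : measurable (dyadic n @^-1` [set k]).
  have [[x <-]|nx] := pselect (exists x, dyadic n x = k).
    by rewrite dyadic_cell; apply: measurable_rect => i; exact: measurable_dyadic_side.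
  rewrite (_ : _ @^-1` _ = set0)//.
  by apply/seteqP; split=> // x /= xk; case: nx; exists x.
split=> //; [exact: dyadic_refine| | exact: dyadic_near| |].
- apply: smallest_sub; first exact: smallest_sigma_algebra.
  rewrite -bigcup_seq; apply: bigcup_sub => i _ _ [B mB <-].
  pose U := g_sigma_algebraType (grid_sets dyadic).
  have : measurable_fun [set: U] (rV_coor i : U -> measurableTypeR R).
    apply: (@measurable_fun_grid _ U R dyadic _ 1) => [n k|n x y /dyadic_near xy].
      by apply: sub_sigma_algebra; exists n, [set k].
    by rewrite mul1r; apply: le_trans xy; have := entry_le_norm (x - y) ord0 i; rewrite !mxE.
  by move=> /(_ measurableT _ mB).
- move=> n x; rewrite dyadic_cell (@leb_rect _ _ (fun=> (2 ^+ n)^-1)).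
  + by rewrite prodr_const card_ord.
  + by move=> i; exact: measurable_dyadic_side.
  + move=> i; rewrite dyadic_sideE lebesgue_measure_itv/= lte_fin ltrDl invr_gt0 exprn_gt0//.
    by rewrite -EFinB addrAC subrr add0r.
- move=> S delta delta0 Sd; have [->|/set0P[x0 Sx0]] := eqVneq S set0.
    by exists set0; [split|rewrite measure0 lee_fin exprn_ge0].
  have lbS i : has_lbound [set x ord0 i | x in S].
    exists (x0 ord0 i - delta) => _ [x Sx <-]; have := Sd _ _ Sx Sx0.
    by move=> /(norm_leP _ delta0)/(_ i); rewrite !mxE ler_norml => /andP[]; lra.
  pose a i := inf [set x ord0 i | x in S].
  exists (rect (fun i => `[a i, a i + delta]%classic)); last first.
    rewrite (@leb_rect _ _ (fun=> delta)) ?prodr_const ?card_ord//.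
    move=> i; rewrite lebesgue_measure_itv/= lte_fin ltrDl -EFinB addrAC subrr add0r.
    by case: ltP => // d0; congr EFin; apply/eqP; rewrite eq_le delta0.
  split; first by apply: measurable_rect => i; exact: measurable_itv.
  move=> x Sx i /=; rewrite in_itv/=; apply/andP; split.
    by apply: ge_inf => //; exists x.
  rewrite -lerBlDr; apply: lb_le_inf; first by exists (x0 ord0 i), x0.
  move=> _ [y Sy <-]; have := Sd _ _ Sx Sy.
  by move=> /(norm_leP _ delta0)/(_ i); rewrite !mxE ler_norml => /andP[]; lra.
Qed.

End dyadic.

(** * Lipschitz functions of one variable *)

Section line.
Context {R : realType}.
Local Notation mu := (@lebesgue_measure R).

(** The part of differentiability that matters here: to the right of [s] the
    function grows at a rate barely above its derivative. *)
Lemma is_derive_right_le (g : R -> R) (s l e : R) : 0 < e -> is_derive s 1 g l ->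
  exists2 del : R, 0 < del &
    forall r, s < r < s + del -> g r - g s <= (l + e) * (r - s).
Proof.
move=> e0 [dg gl].
have : (fun h => h^-1 *: ((g \o shift s) (h *: (1:R)) - g s)) @ 0^' --> l.
  by rewrite -gl; exact: dg.
move=> /cvgrPdist_lt/(_ _ e0); rewrite /dnbhs/= near_withinE => /nbhs_ballP[del /= del0 H].
exists del => // r /andP[sr rs].
have := H (r - s); rewrite /ball/= sub0r normrN gtr0_norm ?subr_gt0//.
rewrite ltrBlDl => /(_ rs); rewrite gt_eqF ?subr_gt0// => /(_ isT).
rewrite /shift/= [_ *: 1]mulr1 subrK => /ltr_distlCDr.
have -> : (r - s)^-1 *: (g r - g s) = (g r - g s) / (r - s) by exact: mulrC.
by rewrite ltr_pdivrMr ?subr_gt0// => /ltW.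
Qed.

(** Continuous induction.  The first hypothesis is an upper semicontinuity from
    the left, so the supremum of the points where [h] is at least [h 0] is
    itself such a point; by the second one it can only be 1. *)
Lemma le_right_progress (h : R -> R) (C : R) : 0 <= C ->
  (forall s r, 0 <= s -> s <= r -> h s - C * (r - s) <= h r) ->
  (forall s, 0 <= s -> s < 1 -> exists2 r, s < r <= 1 & h s <= h r) ->
  h 0 <= h 1.
Proof.
move=> C0 hC step.
pose S := [set s | 0 <= s <= 1 /\ h 0 <= h s].
have S0 : S 0 by split; rewrite ?lexx ?ler01.
have ubS : has_ubound S by exists 1 => s [/andP[]].
have supS : has_sup S by split => //; exists 0.
have c0 : 0 <= sup S by exact: ub_le_sup.
have c1 : sup S <= 1 by apply: ge_sup; [exists 0|move=> s [/andP[]]].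
have hc : h 0 <= h (sup S).
  apply/ler_addgt0Pr => e e0.
  have eC : 0 < e / (C + 1) by rewrite divr_gt0// ltr_wpDl.
  have [s [/andP[s0 s1] hs] sc] := sup_adherent eC supS.
  have sS : s <= sup S by apply: ub_le_sup => //; split; rewrite ?s0.
  rewrite -lerBlDr; apply: le_trans (hC _ _ s0 sS).
  apply: lerB => //.
  apply: (@le_trans _ _ (C * (e / (C + 1)))).
    by rewrite ler_wpM2l//; lra.
  by rewrite mulrA ler_pdivrMr ?ltr_wpDl// mulrC ler_pM2l//; lra.
move: c1; rewrite le_eqVlt => /predU1P[<-//|c1].
have [r /andP[cr r1] hr] := step _ c0 c1.
suff : r <= sup S by rewrite leNgt cr.
apply: ub_le_sup => //; split; last exact: le_trans hr.
by rewrite r1 (le_trans c0 (ltW cr)).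
Qed.

(** Cover [N] by an open set [U] of measure at most [e], and let [phi s] be the
    measure of its part in [[0, s]].  Then
    [(m + e) s + L phi s - g s] does not decrease: outside [U] the derivative
    controls [g], inside [U] the term [L phi s] absorbs the Lipschitz growth.
    Between 0 and 1 the correction [L phi] contributes at most [L e]. *)
Lemma lipschitz_ae_derive_le (g : R -> R) (L m : R) (N : set R) :
  0 <= L -> 0 <= m -> (forall s r, `|g s - g r| <= L * `|s - r|) ->
  measurable N -> mu N = 0%E ->
  (forall s, ~ N s -> exists2 l, l <= m & is_derive s 1 g l) ->
  g 1 - g 0 <= m.
Proof.
move=> L0 m0 gL mN N0 gN.
apply/ler_addgt0Pr => e0 e00.
(* The total loss will be [e + L e = e0]. *)
pose e := e0 / (L + 1).
have e_gt0 : 0 < e by rewrite divr_gt0// ltr_wpDl.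
have Noo : (mu N < +oo)%E by rewrite N0 ltry.
have [U [oU NU UN]] := lebesgue_regularity_outer mN Noo e_gt0.
have mU : measurable U by exact: open_measurable.
have muU : (mu U <= e%:E)%E.
  rewrite -(setDUK NU); apply: le_trans (measureU2 mu mN (measurableD mU mN)) _.
  by rewrite [X in (X + _)%E]N0 add0e; exact: ltW.
have mUs s : measurable (U `&` `[0, s]) by apply: measurableI.
have mu_fin s : mu (U `&` `[0, s]) \is a fin_num.
  rewrite ge0_fin_numE//; apply: le_lt_trans (ltry e); apply: le_trans muU.
  by apply: le_measure; rewrite ?inE; [exact: mUs|exact: mU|exact: subIsetl].
pose phi s := fine (mu (U `&` `[0, s])).
have phi0 s : 0 <= phi s by exact: fine_ge0.
have phie s : phi s <= e.
  rewrite -lee_fin fineK//; apply: le_trans muU.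
  by apply: le_measure; rewrite ?inE; [exact: mUs|exact: mU|exact: subIsetl].
have phi_nd s r : s <= r -> phi s <= phi r.
  move=> sr; apply: fine_le => //.
  apply: le_measure; rewrite ?inE; [exact: mUs|exact: mUs|].
  by apply: setIS => x /=; rewrite !in_itv/= => /andP[-> /le_trans->].
have gLr s r : s <= r -> g r - g s <= L * (r - s).
  by move=> sr; apply: le_trans (ler_norm _) _; rewrite (le_trans (gL _ _))// ger0_norm ?subr_ge0.
pose h s := (m + e) * s + L * phi s - g s.
have : h 0 <= h 1.
  apply: (@le_right_progress h L) => // [s r s0 sr|s s0 s1].
    have := gLr _ _ sr; have := ler_wpM2l L0 (phi_nd _ _ sr).
    have : (m + e) * s <= (m + e) * r by rewrite ler_wpM2l//; lra.
    by rewrite /h; lra.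
  have [Us|nUs] := pselect (U s).
    have /nbhs_ballP[del /= del0 sU] : nbhs s U by exact: open_nbhs_nbhs.
    pose r := Num.min (s + del / 2) 1.
    have rs : r <= s + del / 2 by rewrite ge_min lexx.
    have sr : s < r by rewrite lt_min s1 andbT; lra.
    exists r; first by rewrite sr/= ge_min lexx orbT.
    have : phi s + (r - s) <= phi r.
      rewrite -lee_fin EFinD !fineK//.
      have mI : measurable (`]s, r] : set R) by exact: measurable_itv.
      have -> : (r - s)%:E = mu `]s, r]%classic.
        by rewrite lebesgue_measure_itv/= lte_fin sr EFinB.
      rewrite -measureU//.
        apply: le_measure; rewrite ?inE; [|exact: mUs|].
          by apply: measurableU; [exact: mUs|exact: mI].
        move=> x /= [[Ux]|]; rewrite !in_itv/=.
          by move=> /andP[-> /le_trans->]//; rewrite ltW.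
        move=> /andP[sx xr]; split; last by rewrite xr (le_trans s0 (ltW sx)).
        by apply: sU; rewrite /ball/= ltr_norml; apply/andP; split; lra.
        exact: mUs.
      apply/seteqP; split=> // x /= [[_]]; rewrite !in_itv/= => /andP[_ xs] /andP[].
      by rewrite ltNge xs.
    move=> /(ler_wpM2l L0); have := gLr _ _ (ltW sr).
    have : (m + e) * s <= (m + e) * r by rewrite ler_wpM2l//; lra.
    by rewrite /h mulrDr; lra.
  have [l lm gl] : exists2 l, l <= m & is_derive s 1 g l by apply: gN => /NU.
  have [del del0 H] := is_derive_right_le e_gt0 gl.
  pose r := Num.min (s + del / 2) 1.
  have rs : r <= s + del / 2 by rewrite ge_min lexx.
  have sr : s < r by rewrite lt_min s1 andbT; lra.
  exists r; first by rewrite sr/= ge_min lexx orbT.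
  have : g r - g s <= (l + e) * (r - s) by apply: H; rewrite sr/=; lra.
  have := ler_wpM2l L0 (phi_nd _ _ (ltW sr)).
  have : (l + e) * (r - s) <= (m + e) * (r - s) by rewrite ler_wpM2r//; lra.
  by rewrite /h; lra.
have := ler_wpM2l L0 (phi0 0); have := ler_wpM2l L0 (phie 1).
have -> : e0 = (L + 1) * e by rewrite /e mulrC divfK// gt_eqF// ltr_wpDl.
by rewrite /h; lra.
Qed.

End line.

(** * From the gradient bound to a Lipschitz constant *)

Lemma ae_xsection_null {d1 d2} {T1 : measurableType d1} {T2 : measurableType d2}
    {R : realType} (m1 : {measure set T1 -> \bar R})
    (m2 : {sigma_finite_measure set T2 -> \bar R}) (W : set (T1 * T2)) :
  measurable W -> (m1 \x m2)%E W = 0%E ->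
  {ae m1, forall x, m2 (xsection W x) = 0%E}.
Proof.
move=> mW W0.
have mf : measurable_fun setT (m2 \o xsection W) by exact: measurable_fun_xsection.
have /(ae_eq_integral_abs m1 measurableT mf) : (\int[m1]_x `|(m2 \o xsection W) x| = 0)%E.
  rewrite -[RHS]W0; apply: eq_integral => x _ /=.
  by rewrite gee0_abs.
by apply: filterS => x /(_ I).
Qed.

Section gradient.
Context {R : realType} (d : nat).
Local Notation E := 'rV[R]_d.

(** For each [s] the set of [y] with [y + s h] in [N] is a translate of [N],
    hence null; exchange the order of integration. *)
Lemma ae_null_lines (N : set E) (h : E) : measurable N -> leb d N = 0%E ->
  {ae leb d, forall y, (@lebesgue_measure R) [set s | N (y + s *: h)] = 0%E}.
Proof.
move=> mN N0.
pose T (z : E * measurableTypeR R) : E := z.1 + z.2 *: h.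
have mT : measurable_fun setT T.
  apply/measurable_fun_rVP => i.
  rewrite (_ : _ \o _ = (rV_coor i \o fst) \+ (h ord0 i \*o snd)); last first.
    by apply/funext => z; rewrite /rV_coor/= !mxE mulrC.
  apply: measurable_funD; first exact: measurableT_comp (measurable_rV_coor i) measurable_fst.
  by apply: measurable_funM => //; exact: measurable_snd.
have mW : measurable (T @^-1` N) by rewrite -[X in measurable X]setTI; exact: mT.
have W0 : (leb d \x lebesgue_measure)%E (T @^-1` N) = 0%E.
  rewrite (product_measure_unique (m' := (leb d \x^ lebesgue_measure)%E))//; last first.
    by move=> A B mA mB; exact: product_measure2E.
  apply: integral0_eq => s _ /=.
  have mG : measurable_fun setT (fun y : E => y + s *: h).
    apply/measurable_fun_rVP => i.
    rewrite (_ : _ \o _ = rV_coor i \+ cst (s * h ord0 i)); last first.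
      by apply/funext => z; rewrite /rV_coor/= !mxE.
    by apply: measurable_funD => //; exact: measurable_rV_coor.
  have := expansive_preimage (metric_grid_dyadic d) mG ler01 _ mN.
  rewrite [X in (_ * X)%E]N0 mule0 => H; apply/eqP; rewrite -measure_le0.
  rewrite (_ : ysection _ _ = (fun y => y + s *: h) @^-1` N); last first.
    by apply/seteqP; split=> y; rewrite /ysection/= inE.
  by apply: H => x y; rewrite mul1r opprD addrACA subrr addr0.
have := ae_xsection_null mW W0; apply: filterS => y <-.
by congr lebesgue_measure; apply/seteqP; split=> s; rewrite /xsection/= inE.
Qed.

Lemma ae_dense (P : E -> Prop) : {ae leb d, forall x, P x} ->
  forall x e, 0 < e -> exists2 y, `|y - x| <= e & P y.
Proof.
move=> [N [mN N0 NP]] x e e0; apply: contrapT => nP.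
pose B := rect (fun i => `[x ord0 i - e, x ord0 i + e]%classic).
have mB : measurable B by apply: measurable_rect => i; exact: measurable_itv.
have : leb d B = (\prod_(i < d) (2 * e))%:E.
  apply: leb_rect => i; first exact: measurable_itv.
  rewrite lebesgue_measure_itv/= lte_fin -EFinB.
  by rewrite (_ : _ < _ = true); [congr EFin; lra|apply/idP; lra].
apply/eqP; rewrite lt_eqF//.
apply: (@le_lt_trans _ _ (leb d N)); last by rewrite N0 lte_fin prodr_gt0// => i _; lra.
apply: le_measure; rewrite ?inE// => y By; apply: NP => Py; apply: nP; exists y => //.
apply/norm_leP => [|i]; first exact: ltW.
by have := By i; rewrite /= in_itv/= !mxE ler_norml; lra.
Qed.

Lemma is_derive_coord (gam : R -> E) (s : R) (l : E) i :
  is_derive s 1 gam l -> is_derive s 1 (fun r => gam r ord0 i) (l ord0 i).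
Proof.
move=> [dg <-]; split; first by move/derivable_mxP : dg.
by rewrite (derive_mx dg) mxE.
Qed.

(** The difference quotients of the restriction to the line are those of [F] in
    the direction [h]. *)
Lemma is_derive_line (F : E -> E) (y h : E) (s : R) :
  differentiable F (y + s *: h) ->
  is_derive s 1 (fun r => F (y + r *: h)) (h *m 'J F (y + s *: h)).
Proof.
move=> dF; set a := y + s *: h.
have dv : derivable F a h by exact: diff_derivable.
have lineE :
  (fun u : R => u^-1 *: (((fun r => F (y + r *: h)) \o shift s) (u *: 1) - F a))
    = (fun u => u^-1 *: ((F \o shift a) (u *: h) - F a)).
  apply/funext => u /=; congr (_ *: (F _ - _)).
  by rewrite [u *: 1]mulr1 scalerDl addrCA.
have dg : derivable (fun r : R => F (y + r *: h)) s 1 by rewrite /derivable lineE; exact: dv.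
apply: DeriveDef => //; rewrite -(deriveEjacobian h dF).
by rewrite /derive lineE.
Qed.

(** With entrywise maxima as norms, multiplying by a matrix costs the factor
    [d]; this is where the dimension enters the Lipschitz constant. *)
Lemma mulmx_norm_le (h : E) (A : 'M[R]_d) : `|h *m A| <= d%:R * `|A| * `|h|.
Proof.
apply/norm_leP => [|i]; first by rewrite !mulr_ge0.
rewrite mxE; apply: le_trans (ler_norm_sum _ _ _) _.
rewrite -mulrA mulr_natl -[X in _ *+ X]card_ord -sumr_const; apply: ler_sum => k _.
by rewrite normrM mulrC ler_pM// entry_le_norm.
Qed.

Lemma lipschitz_bound (F : E -> E) : lipschitz F ->
  exists2 L, 0 <= L & forall x y, `|F x - F y| <= L * `|x - y|.
Proof.
move=> [M [Mr H]]; exists (Num.max 0 (M + 1)); first by rewrite le_max lexx.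
move=> x y; apply: (H _ _ (x, y)) => //.
by rewrite lt_max (ltrDl M 1) ltr01 orbT.
Qed.

(** Almost every line of direction [h] meets the points without a controlled
    derivative in a null set, and there the one-variable estimate applies to
    each coordinate and its opposite.  Such lines are dense, and [F] is
    continuous. *)
Lemma grad_Linfty_lipschitz (F : E -> E) (M : R) :
  lipschitz F -> grad_Linfty F = M%:E ->
  forall x y, `|F x - F y| <= d%:R * `|M| * `|x - y|.
Proof.
move=> /lipschitz_bound[L L0 FL] FM.
have [N [mN N0 NF]] : {ae leb d, forall x, (grad_norm F x <= M%:E)%E}.
  by rewrite -FM; exact: ess_sup_ge.
have {}NF x : ~ N x -> differentiable F x /\ `|'J F x| <= `|M|.
  move=> Nx; have : (grad_norm F x <= M%:E)%E by apply: contrapT => /NF.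
  rewrite /grad_norm; case: asboolP => // dF.
  by rewrite lee_fin => /le_trans-> //; exact: ler_norm.
suff H x h : `|F (x + h) - F x| <= d%:R * `|M| * `|h|.
  by move=> x y; have := H y (x - y); rewrite (addrC y) subrK.
have step y : lebesgue_measure [set s | N (y + s *: h)] = 0%E ->
    `|F (y + h) - F y| <= d%:R * `|M| * `|h|.
  move=> y0; set K := d%:R * `|M| * `|h|.
  have K0 : 0 <= K by rewrite !mulr_ge0.
  have mS : measurable [set s | N (y + s *: h)].
    have mline : measurable_fun setT (fun s : measurableTypeR R => y + s *: h).
      apply/measurable_fun_rVP => i.
      rewrite (_ : _ \o _ = cst (y ord0 i) \+ (h ord0 i \*o id)); last first.
        by apply/funext => s; rewrite /rV_coor/= !mxE mulrC.
      by apply: measurable_funD => //; exact: measurable_funM.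
    by have := mline measurableT _ mN; rewrite setTI.
  have dF s : ~ N (y + s *: h) ->
      is_derive s 1 (fun r => F (y + r *: h)) (h *m 'J F (y + s *: h)).
    by move=> /NF[dF _]; exact: is_derive_line.
  have JK s j : ~ N (y + s *: h) -> `|(h *m 'J F (y + s *: h)) ord0 j| <= K.
    move=> /NF[_ JM]; apply: le_trans (entry_le_norm _ _ _) _.
    apply: le_trans (mulmx_norm_le _ _) _.
    by rewrite ler_wpM2r// ler_wpM2l.
  have gL j s r : `|F (y + s *: h) ord0 j - F (y + r *: h) ord0 j| <= L * `|h| * `|s - r|.
    have := entry_le_norm (F (y + s *: h) - F (y + r *: h)) ord0 j.
    rewrite !mxE => /le_trans->//.
    apply: le_trans (FL _ _) _.
    by rewrite opprD addrACA subrr add0r -scalerBl normrZ mulrA mulrAC.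
  apply/norm_leP => // j; rewrite !mxE.
  have := @lipschitz_ae_derive_le R (fun r => F (y + r *: h) ord0 j) (L * `|h|) K
    _ (mulr_ge0 L0 (normr_ge0 h)) K0 (gL j) mS y0.
  have := @lipschitz_ae_derive_le R (fun r => - F (y + r *: h) ord0 j) (L * `|h|) K
    _ (mulr_ge0 L0 (normr_ge0 h)) K0 _ mS y0.
  rewrite !scale1r !scale0r !addr0 => H1 H2; rewrite ler_norml; apply/andP; split.
    rewrite lerNl opprB; rewrite opprK addrC in H1.
    apply: H1 => [s r|s /[dup] /dF ds /JK Js].
      by rewrite -opprD normrN; exact: gL.
    exists (- (h *m 'J F (y + s *: h)) ord0 j); first by have := Js j; rewrite ler_norml; lra.
    by apply: is_deriveN; exact: is_derive_coord.
  apply: H2 => s /[dup] /dF ds /JK Js.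
  exists ((h *m 'J F (y + s *: h)) ord0 j); first by have := Js j; rewrite ler_norml; lra.
  exact: is_derive_coord.
apply/ler_addgt0Pr => e e0.
(* Moving both endpoints by this much changes the increment by at most [e]. *)
have e1 : 0 < e / (2 * L + 1) by rewrite divr_gt0// ltr_wpDl// mulr_ge0.
have [y yx /step Fy] := ae_dense (ae_null_lines h mN N0) x e1.
have Le : 2 * L * `|y - x| <= e.
  apply: (@le_trans _ _ (2 * L * (e / (2 * L + 1)))).
    by rewrite ler_wpM2l// mulr_ge0.
  by rewrite mulrA ler_pdivrMr ?ltr_wpDl ?mulr_ge0// mulrC ler_pM2l//; lra.
have F1 := FL (x + h) (y + h); have F2 := FL y x.
rewrite [x + h]addrC [y + h]addrC opprD addrACA subrr add0r (distrC x y) in F1.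
have -> : F (x + h) - F x = (F (h + x) - F (h + y)) + (F (y + h) - F y) + (F y - F x).
  by rewrite [h + x]addrC [h + y]addrC !addrA !subrK.
apply: le_trans (ler_normD _ _) _; rewrite addrC.
have := ler_normD (F (h + x) - F (h + y)) (F (y + h) - F y); lra.
Qed.

End gradient.

(** * Estimates on the flow *)

Section flow.
Context {R : realType} (d : nat).
Local Notation E := 'rV[R]_d.

Lemma norm_mean_value (gam dgam : R -> E) (T C : R) :
  (forall r : R, is_derive r 1 gam (dgam r)) ->
  (forall r, `|r| <= T -> `|dgam r| <= C) ->
  forall s, `|s| <= T -> `|gam s - gam 0| <= C * `|s|.
Proof.
move=> dg dC s sT; have C0 : 0 <= C := le_trans (normr_ge0 _) (dC _ sT).
apply/norm_leP => [|i]; first by rewrite mulr_ge0.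
rewrite !mxE.
have dgi (r : R) : is_derive r 1 (fun r : R => gam r ord0 i) (dgam r ord0 i).
  exact: is_derive_coord.
have cg a b : {within `[a, b], continuous (fun r : R => gam r ord0 i)}.
  by apply: derivable_within_continuous => r _; case: (dgi r).
have [s0|s0] := leP 0 s.
  have [c] := MVT_segment s0 (fun r _ => dgi r) (cg _ _).
  rewrite in_itv/= => /andP[c0 cs] ->; rewrite subr0 normrM ler_wpM2r//.
  apply: le_trans (entry_le_norm _ _ _) _; apply: dC.
  by rewrite ger0_norm// (le_trans cs)//; apply: le_trans (ler_norm _) sT.
have [c] := MVT_segment (ltW s0) (fun r _ => dgi r) (cg _ _).
rewrite in_itv/= distrC => /andP[sc c0] ->; rewrite sub0r normrM normrN ler_wpM2r//.
apply: le_trans (entry_le_norm _ _ _) _; apply: dC.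
by rewrite ler0_norm//; move: sT; rewrite ltr0_norm//; lra.
Qed.

Definition phase_dist (z w : E * E) : R := Num.max `|z.1 - w.1| `|z.2 - w.2|.

Variables (F : E -> E) (K T : R) (X V : R -> E * E -> E).
Hypothesis K0 : 0 <= K.
Hypothesis FK : forall x y, `|F x - F y| <= K * `|x - y|.
Hypothesis flowXV : is_flow F X V.
Hypothesis T0 : 0 <= T.
Hypothesis KT : (1 + K) * T <= 4^-1.

Let phi t z := (X t z, V t z).

Let X0 z : X 0 z = z.1. Proof. by case: (flowXV z). Qed.
Let V0 z : V 0 z = z.2. Proof. by case: (flowXV z). Qed.
Let dX (t : R) z : is_derive t 1 (X ^~ z) (V t z).
Proof. by case: (flowXV z) => _ _ /(_ t)[]. Qed.
Let dV (t : R) z : is_derive t 1 (V ^~ z) (F (X t z)).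
Proof. by case: (flowXV z) => _ _ /(_ t)[]. Qed.

Let dxi z w (t : R) : is_derive t 1 (fun t : R => X t z - X t w) (V t z - V t w).
Proof. exact: is_deriveB. Qed.
Let deta z w (t : R) : is_derive t 1 (fun t : R => V t z - V t w) (F (X t z) - F (X t w)).
Proof. exact: is_deriveB. Qed.

Let T4 : T <= 4^-1.
Proof. by apply: le_trans KT; rewrite ler_peMl// lerDl. Qed.
Let KT4 : K * T <= 4^-1.
Proof. by apply: le_trans KT; rewrite ler_wpM2r// lerDr. Qed.

(** Mean value inequality for the difference of two characteristics, given an
    a priori bound [B] on their distance. *)
Lemma flow_drift z w B s :
  (forall r, `|r| <= T -> phase_dist (phi r z) (phi r w) <= B) -> `|s| <= T ->
  `|X s z - X s w - (z.1 - w.1)| <= B / 4 /\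
  `|V s z - V s w - (z.2 - w.2)| <= K * B * `|s|.
Proof.
move=> HB sT; have B0 : 0 <= B.
  by apply: le_trans (HB _ sT); rewrite le_max normr_ge0.
have HB1 r : `|r| <= T -> `|X r z - X r w| <= B /\ `|V r z - V r w| <= B.
  by move=> /HB; rewrite ge_max => /andP[].
split.
  have := norm_mean_value (dxi z w) (fun r rT => (HB1 r rT).2) sT.
  rewrite !X0 => /le_trans-> //; rewrite ler_wpM2l//.
  exact: le_trans sT T4.
have := norm_mean_value (C := K * B) (deta z w) _ sT.
rewrite !V0; apply => r rT.
by apply: le_trans (FK _ _) _; rewrite ler_wpM2l//; case: (HB1 r rT).
Qed.

(** In place of the inequality of Gronwall: take for [B] the maximum of the
    distance over the whole interval [[-T, T]].  The drift is then at most a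
    quarter of [B], so [B <= phase_dist z w + B / 4]. *)
Lemma flow_growth z w s : `|s| <= T ->
  phase_dist (phi s z) (phi s w) <= 2 * phase_dist z w.
Proof.
move=> sT; pose om (t : R) := phase_dist (phi t z) (phi t w).
have com : {within `[- T, T], continuous om}.
  apply: continuous_subspaceT => t.
  have cx : {for t, continuous (fun t : R => `|X t z - X t w|)}.
    apply: continuous_comp; last exact: norm_continuous.
    by apply: differentiable_continuous; apply/derivable1_diffP; case: (dxi z w t).
  have cv : {for t, continuous (fun t : R => `|V t z - V t w|)}.
    apply: continuous_comp; last exact: norm_continuous.
    by apply: differentiable_continuous; apply/derivable1_diffP; case: (deta z w t).
  exact: continuous_max cx cv.
have TT : - T <= T by rewrite ge0_cp.
have [c] := EVT_max TT com; rewrite in_itv/= -ler_norml => cT omc.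
have HB r : `|r| <= T -> phase_dist (phi r z) (phi r w) <= om c.
  by move=> rT; apply: omc; rewrite in_itv/= -ler_norml.
have om0 : 0 <= om c by rewrite le_max normr_ge0.
suff : om c <= 2 * phase_dist z w by apply: le_trans; exact: HB.
have [x v] := flow_drift HB cT.
have z1 : `|z.1 - w.1| <= phase_dist z w by rewrite le_max lexx.
have z2 : `|z.2 - w.2| <= phase_dist z w by rewrite le_max lexx orbT.
have KB : K * om c * `|c| <= om c / 4.
  rewrite mulrAC mulrC ler_wpM2l//; apply: le_trans KT4.
  by rewrite ler_wpM2l.
have n1 := lerB_normD (X c z - X c w) (- (z.1 - w.1)).
have n2 := lerB_normD (V c z - V c w) (- (z.2 - w.2)).
rewrite !normrN in n1 n2.
suff : om c <= phase_dist z w + om c / 4 by lra.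
by rewrite {1}/om {1}/phase_dist ge_max /=; apply/andP; split; lra.
Qed.

(** By [flow_growth] the drift is at most half of the initial distance. *)
Lemma flow_expansive z w s : `|s| <= T ->
  phase_dist z w <= 2 * phase_dist (phi s z) (phi s w).
Proof.
move=> sT; set m := phase_dist z w.
have m0 : 0 <= m by rewrite le_max normr_ge0.
have [x v] := flow_drift (fun r => @flow_growth z w r) sT.
have z1 : `|X s z - X s w| <= phase_dist (phi s z) (phi s w) by rewrite le_max lexx.
have z2 : `|V s z - V s w| <= phase_dist (phi s z) (phi s w) by rewrite le_max lexx orbT.
have KB : K * (2 * m) * `|s| <= (2 * m) / 4.
  rewrite mulrAC mulrC ler_wpM2l ?mulr_ge0//; apply: le_trans KT4.
  by rewrite ler_wpM2l.
rewrite distrC in x; rewrite distrC in v.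
have n1 := lerB_normD (z.1 - w.1) (- (X s z - X s w)).
have n2 := lerB_normD (z.2 - w.2) (- (V s z - V s w)).
rewrite !normrN in n1 n2; rewrite -/m in x v.
suff : m <= phase_dist (phi s z) (phi s w) + m / 2 by lra.
by rewrite {1}/m {1}/phase_dist ge_max /=; apply/andP; split; lra.
Qed.

(** The separation of velocities stays within [2 K T |v - w|] of its initial
    value [v - w]; integrating in time, the separation of positions stays
    within [2 K T |v - w| |t|] of that of free transport, [t (v - w)]. *)
Lemma flow_dispersion x v w t : `|t| <= T ->
  `|t| * (1 - 2 * K * T) * `|v - w| <= `|X t (x, v) - X t (x, w)|.
Proof.
move=> tT; set z := (x, v); set z' := (x, w).
have mE : phase_dist z z' = `|v - w|.
  by rewrite /phase_dist/= subrr normr0; apply/max_idPr.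
have dgam (r : R) : is_derive r 1 (fun r : R => X r z - X r z' - r *: (v - w))
    (V r z - V r z' - (v - w)).
  have scale : is_derive r 1 (fun s : R => s *: (v - w)) (v - w).
    have [ds dsE] := is_diff_scalel r (v - w).
    by apply: DeriveDef; [exact: diff_derivable|rewrite deriveE// dsE scale1r].
  exact: is_deriveB.
have := norm_mean_value (C := 2 * K * T * `|v - w|) dgam _ tT.
rewrite scale0r subr0 !X0 subrr subr0 => H.
have {}H : `|X t z - X t z' - t *: (v - w)| <= 2 * K * T * `|v - w| * `|t|.
  apply: H => r rT.
  have [_] := flow_drift (fun r => @flow_growth z z' r) rT; rewrite mE => /le_trans-> //.
  rewrite mulrA (mulrC K) -!mulrA ler_wpM2l// ler_wpM2l//.
  by rewrite mulrC ler_wpM2r.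
rewrite distrC in H.
have xiE : t *: (v - w) - (t *: (v - w) - (X t z - X t z')) = X t z - X t z'.
  by rewrite opprB addrC subrK.
have := lerB_normD (t *: (v - w)) (- (t *: (v - w) - (X t z - X t z'))).
rewrite normrN xiE normrZ => n.
suff : `|t| * (1 - 2 * K * T) * `|v - w| =
  `|t| * `|v - w| - 2 * K * T * `|v - w| * `|t| by lra.
by ring.
Qed.

End flow.

(** * Dispersion *)

Section partial_ess_sup.
Context {d1 d2} {T1 : measurableType d1} {T2 : measurableType d2} {R : realType}.
Variables (m1 : {measure set T1 -> \bar R}) (m2 : {sigma_finite_measure set T2 -> \bar R}).
Variable h : T1 * T2 -> \bar R.
Hypothesis mh : measurable_fun setT h.

Let mhx x : measurable_fun setT (fun y => h (x, y)).
Proof. exact: measurableT_comp mh (measurable_pair1 x). Qed.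

(** The partial essential supremum exceeds [r] exactly when the section of the
    set where [h] exceeds [r] has nonzero measure, and the measure of a section
    is a measurable function. *)
Lemma measurable_partial_ess_sup :
  measurable_fun setT (fun x => ess_sup m2 (fun y => h (x, y))).
Proof.
move=> mT; apply: (measurability _ (ErealGenOInfty.measurableE R)) => //.
move=> _ [_ [r ->] <-]; rewrite setTI.
pose A := h @^-1` `]r%:E, +oo[.
have mA : measurable A.
  by rewrite -[A]setTI; apply: mh => //; exact: emeasurable_itv.
rewrite (_ : _ @^-1` _ = (m2 \o xsection A) @^-1` (~` [set 0%E])).
  rewrite -[X in measurable X]setTI; apply: measurable_fun_xsection => //.
  exact/measurableC.
have secE x : (ess_sup m2 (fun y => h (x, y)) <= r%:E)%E <-> m2 (xsection A x) = 0%E.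
  have -> : xsection A x = (fun y => h (x, y)) @^-1` `]r%:E, +oo[.
    by apply/seteqP; split=> y; rewrite /xsection/= inE.
  by rewrite -(ae_le_measureP m2 r%:E (mhx x)); split=> [/ess_supP|?]//; exact/ess_supP.
apply/seteqP; split=> x /=; rewrite in_itv/= andbT ltNge.
  by move=> /negP H /secE.
by move=> H; apply/negP => /secE.
Qed.

Lemma above_partial_ess_sup_null :
  (m1 \x m2)%E [set z | (ess_sup m2 (fun y => h (z.1, y)) < h z)%E] = 0%E.
Proof.
apply: integral0_eq => x _ /=; apply: measure_negligible.
  apply: measurable_xsection; rewrite -[X in measurable X]setTI.
  apply: measurable_lte => //.
  exact: measurableT_comp measurable_partial_ess_sup measurable_fst.
have [N [mN N0 HN]] := ess_sup_ge m2 (fun y => h (x, y)).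
exists N; split=> // y; rewrite /xsection/= inE /= => H.
by apply: HN => /=; apply/negP; rewrite -ltNge.
Qed.

End partial_ess_sup.

Lemma bernoulli_half (R : realType) (n : nat) (a : R) :
  0 <= a <= 1 -> n%:R * a <= 2^-1 -> 2^-1 <= (1 - a) ^+ n.
Proof.
move=> /andP[a0 a1] na; apply: (@le_trans _ _ (1 - n%:R * a)); first by lra.
elim: n {na} => [|n IH]; first by rewrite expr0 mul0r subr0.
rewrite exprSr; apply: (@le_trans _ _ ((1 - n%:R * a) * (1 - a))).
  rewrite -natr1; have : 0 <= n%:R * a * a by rewrite !mulr_ge0.
  lra.
by rewrite ler_wpM2r// subr_ge0.
Qed.

Lemma leb_ess_sup_ge0 (R : realType) d (h : 'rV[R]_d -> \bar R) :
  (forall v, 0 <= h v)%E -> (0 <= ess_sup (leb d) h)%E.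
Proof.
move=> h0; apply/ereal_infP => c /= /(ae_dense) /(_ 0 1 ltr01)[v _].
exact: le_trans.
Qed.

Section dispersion.
Context {R : realType} (d : nat).
Local Notation E := 'rV[R]_d.
Variables (F : E -> E) (K T : R) (X V : R -> E * E -> E).
Hypothesis K0 : 0 <= K.
Hypothesis FK : forall x y, `|F x - F y| <= K * `|x - y|.
Hypothesis flowXV : is_flow F X V.
Hypothesis T0 : 0 <= T.
Hypothesis KT : (1 + K) * T <= 4^-1.

Let grid2 : metric_grid (pair_grid (@dyadic R d) (@dyadic R d))
  (@phase_dist R d) (d + d) (leb2 d).
Proof. exact: metric_grid_pair (metric_grid_dyadic d) (metric_grid_dyadic d). Qed.

Lemma measurable_phase_lipschitz (G : E * E -> E) (L : R) : 0 <= L ->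
  (forall z w, `|G z - G w| <= L * phase_dist z w) -> measurable_fun setT G.
Proof.
move=> L0 GL; apply/measurable_fun_rVP => i.
apply: (measurable_fun_grid (mg_cell grid2) (K := L)) => n z w /(mg_near grid2) zw.
have := entry_le_norm (G z - G w) ord0 i; rewrite !mxE => /le_trans -> //.
by apply: le_trans (GL _ _) _; rewrite ler_wpM2l.
Qed.

Lemma measurable_flow s : `|s| <= T ->
  measurable_fun setT (X s) /\ measurable_fun setT (V s).
Proof.
move=> sT; split; apply: (measurable_phase_lipschitz (L := 2)) => // z w;
  apply: le_trans (flow_growth K0 FK flowXV T0 KT z w sT);
  by rewrite le_max lexx ?orbT.
Qed.

Lemma flow_null s N : `|s| <= T -> measurable N -> leb2 d N = 0%E ->
  leb2 d ((fun z => (X s z, V s z)) @^-1` N) = 0%E.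
Proof.
move=> sT mN N0; have [mX mV] := measurable_flow sT.
have mphi : measurable_fun setT (fun z => (X s z, V s z)) by exact: measurable_fun_pair.
have := expansive_preimage grid2 mphi (ler0n _ 2)
  (fun z w => flow_expansive K0 FK flowXV T0 KT z w sT) mN.
by rewrite [X in (_ * X)%E]N0 mule0 => H; apply/eqP; rewrite -measure_le0.
Qed.

Lemma flow_dispersion_measure s x A : 0 < `|s| <= T -> 2 * K * T < 1 -> measurable A ->
  (leb d ((fun v => X s (x, v)) @^-1` A) <=
    ((`|s| * (1 - 2 * K * T))^-1 ^+ d)%:E * leb d A)%E.
Proof.
move=> /andP[s0 sT] KT1; have [mX _] := measurable_flow sT.
have c0 : 0 < `|s| * (1 - 2 * K * T) by rewrite mulr_gt0// subr_gt0.
apply: (expansive_preimage (metric_grid_dyadic d)).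
- exact: measurableT_comp mX (measurable_pair1 x).
- by rewrite invr_ge0 ltW.
- move=> v w; rewrite mulrC ler_pdivlMr// mulrC.
  exact: (flow_dispersion K0 FK flowXV T0 KT).
Qed.

(** Outside a null set [W] of phase space, [f t] is given by the
    characteristics and [f0] is below its partial essential supremum [g] at
    their feet.  Almost every section of [W] is null, which gives the bound by
    the integral of [g] along [v |-> X(-t; x, v)]. *)
Lemma transport_Linfty_L1_le (f0 : E * E -> R) (f : R -> E * E -> R) t :
  measurable_fun setT f0 -> measurable_fun setT (f t) ->
  {ae leb2 d, forall z, f t z = f0 (X (- t) z, V (- t) z)} ->
  0 < `|t| <= T -> 2 * K * T < 1 ->
  (norm_Linfty_L1 (f t) <=
    ((`|t| * (1 - 2 * K * T))^-1 ^+ d)%:E * norm_L1_Linfty f0)%E.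
Proof.
move=> mf0 mft [N1 [mN1 N10 HN1]] tT KT1; apply/ess_supP.
have sT : 0 < `|- t| <= T by rewrite normrN.
have /andP[_ sT'] := sT.
have [mX mV] := measurable_flow sT'.
have mphi : measurable_fun setT (fun z => (X (- t) z, V (- t) z)) by exact: measurable_fun_pair.
pose h z := (`|f0 z|)%:E.
have mh : measurable_fun setT h.
  by apply/measurable_EFinP; exact: measurableT_comp.
pose g y := ess_sup (leb d) (fun v => h (y, v)).
have mg : measurable_fun setT g by exact: measurable_partial_ess_sup.
have g0 y : (0 <= g y)%E by apply: leb_ess_sup_ge0 => v; rewrite lee_fin.
pose N2 := [set z | (g z.1 < h z)%E].
have mN2 : measurable N2.
  rewrite -[N2]setTI; apply: measurable_lte => //.
  exact: measurableT_comp mg measurable_fst.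
have N20 : leb2 d N2 = 0%E by exact: above_partial_ess_sup_null.
pose W := N1 `|` (fun z => (X (- t) z, V (- t) z)) @^-1` N2.
have mP : measurable ((fun z => (X (- t) z, V (- t) z)) @^-1` N2).
  by rewrite -[X in measurable X]setTI; exact: mphi.
have mW : measurable W by exact: measurableU.
have W0 : leb2 d W = 0%E by rewrite measureU0//; exact: flow_null.
have := ae_xsection_null mW W0; apply: filterS => x Wx.
have mG : measurable_fun setT (fun v => X (- t) (x, v)).
  exact: measurableT_comp mX (measurable_pair1 x).
set C := (_ ^+ d).
have C0 : 0 <= C.
  by rewrite exprn_ge0// invr_ge0 mulr_ge0// subr_ge0 ltW.
apply: (@le_trans _ _ (\int[leb d]_v g (X (- t) (x, v)))%E).
  apply: ae_ge0_le_integral => //.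
  - apply/measurable_EFinP; apply: measurableT_comp => //.
    exact: measurableT_comp mft (measurable_pair1 x).
  - exact: measurableT_comp mg mG.
  exists (xsection W x); split=> //; first exact: measurable_xsection.
  move=> v /= nv; rewrite /xsection/= inE; apply: contrapT => nW; apply: nv => _.
  have -> : f t (x, v) = f0 (X (- t) (x, v), V (- t) (x, v)).
    by apply: contrapT => fN; apply: nW; left; exact: HN1.
  by rewrite leNgt; apply/negP => gN; apply: nW; right.
(* Compare the image of Lebesgue measure under [v |-> X(-t; x, v)] with [C] times
   Lebesgue measure. *)
rewrite -(ge0_integral_pushforward mG (leb d) (f := g) measurableT)//.
pose push : {measure set E -> \bar R} :=
  measure_function_pushforward__canonical__measure_function_Measure (leb d) mG.
have H S : measurable S -> (push S <= mscale (NngNum C0) (leb d) S)%E.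
  by move=> mS; have := flow_dispersion_measure x sT KT1 mS; rewrite normrN.
apply: le_trans (ge0_le_measure_integral H measurableT g0 mg) _.
by rewrite (ge0_integral_mscale (leb d) measurableT (NngNum C0) mg).
Qed.

End dispersion.

Theorem proposition1 (R : realType) (d : nat) (hd : (1 <= d)%N) (M : R) :
  exists2 tau : R, 0 < tau &
    forall (p : R) (F : 'rV[R]_d -> 'rV[R]_d)
           (f0 : 'rV[R]_d * 'rV[R]_d -> R)
           (f : R -> 'rV[R]_d * 'rV[R]_d -> R),
      1 < p ->
      lipschitz F ->
      grad_Linfty F = M%:E ->
      f0 \in Lfun (leb2 d) p%:E ->
      transport_solution F f0 f ->
      forall t : R, 0 < `|t| <= tau ->
        (norm_Linfty_L1 (f t) <=
           (2 / `|t| ^+ d)%:E * norm_L1_Linfty f0)%E.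
Proof.
pose K : R := d%:R * `|M|.
have K0 : 0 <= K by rewrite mulr_ge0.
have d1 : 1 <= d%:R :> R by rewrite ler1n.
(* Makes [2 K T] at most [1 / (2 d)], so that [(1 - 2 K T) ^ d] is at least 1/2. *)
pose T : R := (4 * d%:R * (1 + K))^-1.
have T0 : 0 < T by rewrite invr_gt0 !mulr_gt0//; lra.
exists T => // p F f0 f _ Flip FM f0p [X [V [flowXV fE]]] t tT.
have dKT : d%:R * ((1 + K) * T) = 4^-1.
  by rewrite /T; field; rewrite !gt_eqF//; lra.
have KT : (1 + K) * T <= 4^-1.
  by rewrite -dKT ler_peMl// mulr_ge0//; [lra|exact: ltW].
have KT0 : 0 <= K * T by rewrite mulr_ge0// ltW.
have KT1 : 2 * K * T < 1 by lra.
have mf0 : measurable_fun setT f0.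
  by have /sub_Lfun_mfun := f0p; rewrite inE.
have [mft aeE] := fE t.
apply: le_trans (transport_Linfty_L1_le K0 (grad_Linfty_lipschitz Flip FM) flowXV
  (ltW T0) KT mf0 mft aeE tT KT1) _.
apply: lee_wpmul2r.
  by apply: integral_ge0 => y _; apply: leb_ess_sup_ge0 => v; rewrite lee_fin.
have /andP[t0 _] := tT.
rewrite lee_fin invfM exprMn [X in _ <= X]mulrC exprVn ler_wpM2l ?invr_ge0 ?exprn_ge0//.
have half : 2^-1 <= (1 - 2 * K * T) ^+ d.
  apply: bernoulli_half; first by apply/andP; split; lra.
  have : d%:R * ((1 + K) * T) - d%:R * T = d%:R * (K * T) by ring.
  have : 0 <= d%:R * T by rewrite mulr_ge0// ltW.
  by rewrite dKT; lra.
rewrite exprVn -[leRHS]invrK lef_pV2// posrE; last by rewrite invr_gt0.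
by apply: lt_le_trans half; rewrite invr_gt0.
Qed.
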